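(* There is a constant $C$ such that for all sufficiently large $n$, $$\tfrac{5}{2}n \le \mathrm{sis}(n,C_4) \le \tfrac{7}{64}n^2 + Cn.$$
   Context: All graphs are finite and simple; $C_4$ is the cycle on four vertices. For a graph $H$, a graph $G$ is $H$-induced-saturated if $G$ contains no induced subgraph isomorphic to $H$, but for every pair of distinct vertices $u,v$ of $G$, the graph obtained from $G$ by adding the edge $uv$ (if $uv\notin E(G)$) or deleting it (if $uv\in E(G)$) contains an induced subgraph isomorphic to $H$. When an $n$-vertex $H$-induced-saturated graph exists, $\mathrm{sis}(n,H)$ denotes the minimum number of edges in an $n$-vertex $H$-induced-saturated graph (for $H = C_4$ such graphs exist for all $n\ge 12$). *)

(* Defs.v *)
From mathcomp Require Import all_boot.

Set Implicit Arguments.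
Unset Strict Implicit.
Unset Printing Implicit Defensive.

Record sgraph (V : finType) := SGraph {
  adj : rel V;
  adj_sym : symmetric adj;
  adj_irr : irreflexive adj }.

Definition edge_set (V : finType) (G : sgraph V) : {set {set V}} :=
  [set [set p.1; p.2] | p : V * V & adj G p.1 p.2].

Definition num_edges (V : finType) (G : sgraph V) : nat := #|edge_set G|.

Section InducedSubgraph.
Variables (V : finType) (G : sgraph V) (S : {set V}).

Definition induced_adj : rel {x : V | x \in S} :=
  fun x y => adj G (val x) (val y).

Lemma induced_sym : symmetric induced_adj.
Proof. by move=> x y; apply: adj_sym. Qed.

Lemma induced_irr : irreflexive induced_adj.
Proof. by move=> x; apply: adj_irr. Qed.

Definition induced : sgraph {x : V | x \in S} := SGraph induced_sym induced_irr.

End InducedSubgraph.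

Definition isomorphic (V W : finType) (G : sgraph V) (H : sgraph W) : Prop :=
  exists f : V -> W, bijective f /\ forall x y, adj H (f x) (f y) = adj G x y.

Definition has_induced (V W : finType) (H : sgraph W) (G : sgraph V) : Prop :=
  exists S : {set V}, isomorphic (induced G S) H.

Section EditEdge.
Variables (V : finType) (G : sgraph V) (u v : V).

(* The conjunct x != y keeps the result loopless in the degenerate case
   u = v, where add_edge does nothing. *)
Definition add_edge_adj : rel V :=
  fun x y => adj G x y || (x != y) && ([set x; y] == [set u; v]).

Lemma add_edge_sym : symmetric add_edge_adj.
Proof. by move=> x y; rewrite /add_edge_adj adj_sym eq_sym setUC. Qed.

Lemma add_edge_irr : irreflexive add_edge_adj.
Proof. by move=> x; rewrite /add_edge_adj adj_irr eqxx. Qed.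

Definition add_edge : sgraph V := SGraph add_edge_sym add_edge_irr.

Definition del_edge_adj : rel V :=
  fun x y => adj G x y && ([set x; y] != [set u; v]).

Lemma del_edge_sym : symmetric del_edge_adj.
Proof. by move=> x y; rewrite /del_edge_adj adj_sym setUC. Qed.

Lemma del_edge_irr : irreflexive del_edge_adj.
Proof. by move=> x; rewrite /del_edge_adj adj_irr. Qed.

Definition del_edge : sgraph V := SGraph del_edge_sym del_edge_irr.

End EditEdge.

Definition induced_saturated (V W : finType) (H : sgraph W) (G : sgraph V)
    : Prop :=
  ~ has_induced H G /\
  forall u v : V, u != v ->
    has_induced H (if adj G u v then del_edge G u v else add_edge G u v).

(* is_sis n H m: n-vertex H-induced-saturated graphs exist, and m is the
   minimum number of edges of such a graph, i.e. sis(n, H) is defined and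
   equal to m. *)
Definition is_sis (n : nat) (W : finType) (H : sgraph W) (m : nat) : Prop :=
  (exists G : sgraph 'I_n, induced_saturated H G /\ num_edges G = m) /\
  (forall G : sgraph 'I_n, induced_saturated H G -> m <= num_edges G).

Definition C4_adj : rel 'I_4 :=
  fun i j => (j == i.+1 %% 4 :> nat) || (i == j.+1 %% 4 :> nat).

Lemma C4_sym : symmetric C4_adj.
Proof. by move=> i j; rewrite /C4_adj orbC. Qed.

Lemma C4_irr : irreflexive C4_adj.
Proof. by case=> [[|[|[|[|]]]] ?]. Qed.

Definition C4 : sgraph 'I_4 := SGraph C4_sym C4_irr.

(* Main.v *)
Require Import Defs.
From HB Require Import structures.
From mathcomp Require Import all_boot all_order all_algebra.
From mathcomp Require Import reals boolp zify lra.
Import Order.TTheory GRing.Theory Num.Theory.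

Set Implicit Arguments.
Unset Strict Implicit.
Unset Printing Implicit Defensive.

(** Lower bound: deleting an edge uv must create an induced C4 with u and v
    opposite, so u and v have two nonadjacent common neighbours. Hence no vertex
    of the graph induced on a neighbourhood N(v) is simplicial; since that graph
    has no induced C4 either, it has at least 5 vertices, and all degrees are at
    least 5.

    Upper bound: replacing the vertices of a C4-induced-saturated graph by
    cliques preserves induced saturation. The circulant graph on Z/21 with
    connection set {1, 4, 5, -1, -4, -5}, a 6-regular triangulation of the torus,
    is C4-induced-saturated, and the 7 multiples of 3 are independent in it.
    Blowing up only these 7 vertices, evenly, gives n^2/14 + O(n) edges, which is
    less than 7n^2/64 + O(n). *)

(** * Induced 4-cycles as vertex quadruples *)

Lemma adj_neq (V : finType) (G : sgraph V) (x y : V) : adj G x y -> x != y.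
Proof. by apply: contraTneq => ->; rewrite adj_irr. Qed.

(** Only opposite vertices need an explicit inequality: adjacent ones differ because [adj] is
    irreflexive. *)
Definition induced_C4 (V : finType) (G : sgraph V) (a b c d : V) : bool :=
  [&& [&& adj G a b, adj G b c, adj G c d & adj G d a],
      a != c, b != d, ~~ adj G a c & ~~ adj G b d].

Lemma has_induced_C4P (V : finType) (G : sgraph V) :
  has_induced C4 G <-> exists a b c d, induced_C4 G a b c d.
Proof.
split=> [[S [f [[g fK gK] f_adj]]]|[a [b [c [d]]]]].
  have g_adj i j : adj G (val (g i)) (val (g j)) = C4_adj i j.
    by rewrite -[LHS]/(adj (induced G S) (g i) (g j)) -f_adj !gK.
  have g_inj i j : (val (g i) == val (g j)) = (i == j).
    by rewrite (inj_eq val_inj) (can_eq gK).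
  pose o k (lt_k4 : k < 4) := val (g (Ordinal lt_k4)).
  exists (@o 0 isT), (@o 1 isT), (@o 2 isT), (@o 3 isT).
  by rewrite /induced_C4 !g_adj !g_inj.
case/and5P=> /and4P[ab bc cd da] ac bd nac nbd.
pose h (i : 'I_4) := nth a [:: a; b; c; d] i.
have h_adj i j : adj G (h i) (h j) = C4_adj i j.
  case: i j => [[|[|[|[|//]]]] ?] [[|[|[|[|//]]]] ?];
  by rewrite /h /C4_adj /= ?adj_irr ?ab ?bc ?cd ?da ?(negPf nac) ?(negPf nbd) //
     adj_sym ?ab ?bc ?cd ?da ?(negPf nac) ?(negPf nbd).
have h_inj : injective h.
  move=> i j /eqP; rewrite nth_uniq ?ltn_ord // => [/eqP/val_inj //|].
  rewrite /= !inE !negb_or ac bd (adj_neq ab) (adj_neq bc) (adj_neq cd).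
  by rewrite eq_sym (adj_neq da).
have hS i : h i \in [set h i | i in 'I_4] by apply: imset_f.
pose h' i : {x : V | x \in [set h i | i in 'I_4]} := Sub (h i) (hS i).
have h'_inj : injective h' by move=> i j /(congr1 val) /h_inj.
have [|f h'K fK] := inj_card_bij h'_inj.
  by rewrite card_sig -[X in _ <= X](card_imset predT h_inj).
exists [set h i | i in 'I_4], f; split; first by exists h'.
move=> x y; rewrite -[x in RHS]fK -[y in RHS]fK.
exact/esym/h_adj.
Qed.

Lemma induced_C4_rot (V : finType) (G : sgraph V) (a b c d : V) :
  induced_C4 G a b c d -> induced_C4 G b c d a.
Proof.
case/and5P=> /and4P[ab bc cd da] ac bd nac nbd.
by rewrite /induced_C4 ab bc cd da bd eq_sym ac nbd adj_sym nac.
Qed.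

Lemma set2_eq (V : finType) (a b u v : V) :
  [set a; b] = [set u; v] -> (a = u /\ b = v) \/ (a = v /\ b = u).
Proof.
move=> e.
have: a \in [set u; v] by rewrite -e set21.
have: b \in [set u; v] by rewrite -e set22.
have: u \in [set a; b] by rewrite e set21.
have: v \in [set a; b] by rewrite e set22.
rewrite !inE.
by do 4 (case/orP=> /eqP ?); subst; (left + right).
Qed.

(** * Minimum degree of a saturated graph *)

Section NecessaryConditions.
Variables (V : finType) (G : sgraph V).
Hypothesis satG : induced_saturated C4 G.

Lemma saturated_C4_free (a b c d : V) : ~~ induced_C4 G a b c d.
Proof.
by apply/negP => C; apply: satG.1; apply/has_induced_C4P; exists a, b, c, d.
Qed.

(** In an induced 4-cycle created by deleting [uv], the vertices [u] and [v] are opposite, or it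
    would already be induced in [G]. The other diagonal gives [a] and [b]. *)
Lemma saturated_edge (u v : V) : adj G u v ->
  exists a b, [/\ a != b, ~~ adj G a b, adj G u a && adj G v a
                & adj G u b && adj G v b].
Proof.
move=> uv; have := satG.2 _ _ (adj_neq uv); rewrite uv.
case/has_induced_C4P=> [a [b [c [d C]]]].
have diag a' b' c' d' : induced_C4 (del_edge G u v) a' b' c' d' ->
    [set a'; c'] = [set u; v] ->
    exists a b, [/\ a != b, ~~ adj G a b, adj G u a && adj G v a
                & adj G u b && adj G v b].
  case/and5P=> /and4P[/andP[ab _] /andP[bc _] /andP[cd _] /andP[da _]] ac bd _ nbd eac.
  exists b', d'; have nbd' : ~~ adj G b' d'.
    apply: contra nbd => bd'; rewrite /= /del_edge_adj bd' /= -eac.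
    apply/negP=> /eqP/set2_eq[] [? ?]; subst.
      by rewrite adj_irr in ab.
    by rewrite adj_irr in bc.
  by case/set2_eq: eac => -[? ?]; subst; split;
    rewrite // ?ab ?bc ?cd ?da 1?adj_sym ?ab ?bc ?cd ?da // 1?adj_sym.
have [/eqP|nac] := boolP ([set a; c] == [set u; v]); first exact: diag C.
have [/eqP|nbd] := boolP ([set b; d] == [set u; v]).
  exact: diag (induced_C4_rot C).
case/negP: (saturated_C4_free a b c d); move: C.
rewrite /induced_C4 /= /del_edge_adj nac nbd !andbT.
by case/and5P=> /and4P[/andP[-> _] /andP[-> _] /andP[-> _] /andP[-> _]] -> -> -> ->.
Qed.

(** An isolated [v] would have degree 1 after adding [uv], hence lie on no 4-cycle, so the new
    induced 4-cycle would already be in [G]. *)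
Lemma saturated_no_isolated (u v : V) : u != v -> exists w, adj G v w.
Proof.
move=> uv; case: (pickP (adj G v)) => [w vw|iso]; first by exists w.
have := satG.2 _ _ uv; rewrite adj_sym iso.
case/has_induced_C4P=> [a [b [c [d C]]]].
have notv a' b' c' d' : induced_C4 (add_edge G u v) a' b' c' d' -> a' != v.
  case/and5P=> /= /and4P[ab _ _ da] _ bd _ _; apply: contraNneq bd => av; subst a'.
  move: ab da; rewrite /add_edge_adj (adj_sym G d') !iso /=.
  case/andP=> n1 /eqP/set2_eq e1 /andP[n2 /eqP/set2_eq e2].
  by case: e1 e2 => -[e e'] [] [e2 e2']; subst; rewrite ?eqxx in n1 n2 uv *.
have C2 := induced_C4_rot C; have C3 := induced_C4_rot C2.
have {}notv : [/\ a != v, b != v, c != v & d != v].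
  by split; [apply: notv C | apply: notv C2 | apply: notv C3
            | apply: notv (induced_C4_rot C3)].
have old x y : x != v -> y != v -> adj (add_edge G u v) x y = adj G x y.
  move=> xv yv; rewrite /= /add_edge_adj.
  suff /negPf-> : [set x; y] != [set u; v] by rewrite andbF orbF.
  apply/eqP=> /set2_eq[] [? ?]; subst; last by rewrite eqxx in xv.
  by rewrite eqxx in yv.
case: notv => av bv cv dv; case/negP: (saturated_C4_free a b c d).
by move: C; rewrite /induced_C4 !old.
Qed.

(** The edge [vw] has nonadjacent common neighbours [a], [b]. Unless five neighbours of [v] appear
    at once, the edges [va] and [vb] give neighbours [x] of [a] and [y] of [b], both in the
    neighbourhood of [v] and not adjacent to [w]; then [w], [a], [b], [x], [y] are distinct. *)
Lemma saturated_degree (u v : V) : u != v -> 5 <= #|[set w | adj G v w]|.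
Proof.
case/saturated_no_isolated=> w vw.
have card5 (s : seq V) : uniq s -> all (adj G v) s ->
    size s <= #|[set w | adj G v w]|.
  move=> Us /allP vs; rewrite -(card_uniqP Us); apply/subset_leq_card/subsetP.
  by move=> x xs; rewrite inE vs.
have [a [b [ab nab /andP[va wa] /andP[vb wb]]]] := saturated_edge vw.
have extra z z' : adj G v z -> adj G w z -> adj G v z' -> adj G w z' ->
    z != z' -> ~~ adj G z z' ->
    5 <= #|[set w | adj G v w]| \/
    exists x, [/\ adj G v x, adj G z x, x != w & ~~ adj G x w].
  move=> vz wz vz' wz' zz' nzz'.
  have [x [y [xy nxy /andP[vx zx] /andP[vy zy]]]] := saturated_edge vz.
  (* At most one of [x], [y] is [w], and then the other is the vertex sought; if neither is, [w],
     [z], [z'], [x], [y] are distinct. *)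
  have [xw|xw] := eqVneq x w.
    right; exists y; rewrite -xw eq_sym xy (adj_sym G y x); by split.
  have [yw|yw] := eqVneq y w.
    by right; exists x; rewrite -yw; split.
  left; apply: (card5 [:: w; z; z'; x; y]); last by rewrite /= vw vz vz' vx vy.
  have nz' t : adj G z t -> z' != t by apply: contraTneq => <-.
  rewrite /= !inE !negb_or (adj_neq wz) (adj_neq wz') zz' xy.
  by rewrite (adj_neq zx) (adj_neq zy) !nz' // !(eq_sym w) xw yw.
case: (extra a b) => // -[x [vx ax xw nxw]].
case: (extra b a) => //; rewrite 1?eq_sym 1?(adj_sym G b a) //.
move=> -[y [vy by_ yw nyw]].
have [exy|xy] := eqVneq x y.
  (* If [x = y], then [x], [a], [w], [b] form an induced 4-cycle. *)
  subst y; case/negP: (saturated_C4_free x a w b).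
  by rewrite /induced_C4 (adj_sym G x a) ax (adj_sym G a w) wa wb by_ xw ab nxw.
apply: (card5 [:: w; a; b; x; y]); last by rewrite /= vw va vb vx vy.
have ay : a != y by apply: contraTneq by_ => <-; rewrite adj_sym.
have bx : b != x by apply: contraTneq ax => <-.
rewrite /= !inE !negb_or (adj_neq wa) (adj_neq wb) ab xy (adj_neq ax) ay bx.
by rewrite (adj_neq by_) !(eq_sym w) xw yw.
Qed.

End NecessaryConditions.

(** * Counting edges by degrees *)

(** Partition the ordered adjacent pairs by their underlying set: each edge arises from exactly
    two. *)
Lemma double_num_edges (V : finType) (G : sgraph V) :
  (num_edges G).*2 = #|[set p : V * V | adj G p.1 p.2]|.
Proof.
pose e (p : V * V) := [set p.1; p.2].
rewrite -sum1_card (partition_big e [in edge_set G]) /= => [|p]; last first.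
  by rewrite inE => pG; apply/imsetP; exists p; rewrite ?inE.
rewrite -muln2 /num_edges -sum_nat_const; apply: eq_bigr => E.
case/imsetP=> -[x y]; rewrite inE /= => xy ->; rewrite sum1_card.
have <- : #|[set (x, y); (y, x)]| = 2.
  by rewrite cards2 xpair_eqE negb_and (adj_neq xy).
apply: eq_card => -[x' y']; rewrite !inE unfold_in inE /= !xpair_eqE /e /=.
apply/orP/andP=> [[] /andP[/eqP-> /eqP->]|[_ /eqP/set2_eq[] [-> ->]]].
- by rewrite xy.
- by rewrite adj_sym xy setUC.
- by left; rewrite !eqxx.
- by right; rewrite !eqxx.
Qed.

Lemma saturated_num_edges (V : finType) (G : sgraph V) :
  1 < #|V| -> induced_saturated C4 G -> 5 * #|V| <= (num_edges G).*2.
Proof.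
move=> V2 satG; rewrite double_num_edges -sum1dep_card.
rewrite -(pair_big_dep xpredT (adj G) (fun _ _ => 1)) /= mulnC -sum_nat_const.
apply: leq_sum => v _; rewrite sum1dep_card.
have [u uv] : exists u, u != v.
  case: (pickP (predC1 v)) => [u uv|all_v]; first by exists u.
  move: V2; rewrite ltnNge -(card1 v) subset_leq_card //.
  by apply/subsetP=> u _; have /negbFE := all_v u.
exact: saturated_degree uv.
Qed.

(** * Replacing vertices by cliques *)

Section BlowUp.
Variables (V W : finType) (B : sgraph W) (f : V -> W).

Definition blow_up_adj : rel V :=
  fun x y => (x != y) && ((f x == f y) || adj B (f x) (f y)).

Lemma blow_up_sym : symmetric blow_up_adj.
Proof. by move=> x y; rewrite /blow_up_adj adj_sym !(eq_sym x, eq_sym (f x)). Qed.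

Lemma blow_up_irr : irreflexive blow_up_adj.
Proof. by move=> x; rewrite /blow_up_adj eqxx. Qed.

Definition blow_up : sgraph V := SGraph blow_up_sym blow_up_irr.

Hypothesis C4_free : forall a b c d, ~~ induced_C4 B a b c d.
(** The case [u = v] serves the edges inside a fibre of [f]. *)
Hypothesis edge_diamond : forall u v, (u == v) || adj B u v ->
  exists a b, [/\ a != b, ~~ adj B a b, adj B u a && adj B v a
                & adj B u b && adj B v b].
(** Adding [uv] closes the induced path [u], [a], [b], [v] to an induced 4-cycle. *)
Hypothesis nonedge_P4 : forall u v, u != v -> ~~ adj B u v ->
  exists a b, [/\ adj B u a, adj B a b, adj B b v, ~~ adj B u b & ~~ adj B a v].
Variable g : W -> V.
Hypothesis gK : cancel g f.

Let adjfg x w : adj B (f x) w -> blow_up_adj x (g w).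
Proof.
move=> xw; rewrite /blow_up_adj gK xw orbT andbT.
by apply: contraTneq xw => ->; rewrite gK adj_irr.
Qed.

Let nadjfg x w : f x != w -> ~~ adj B (f x) w -> ~~ blow_up_adj x (g w).
Proof. by rewrite /blow_up_adj gK => /negPf-> /negPf->; rewrite andbF. Qed.

(** Vertices of one fibre are twins, so consecutive vertices of an induced 4-cycle lie in different
    fibres and the cycle projects to one in [B]. For an edited pair, [u] and [v] are kept and the
    other two vertices are representatives chosen by [g]. *)
Lemma blow_up_saturated : induced_saturated C4 blow_up.
Proof.
split=> [/has_induced_C4P[a [b [c [d C]]]]|u v uv].
  have lift x y z : blow_up_adj x y -> blow_up_adj y z -> x != z ->
      ~~ blow_up_adj x z -> adj B (f x) (f y).
    rewrite /blow_up_adj => /andP[_ /orP[/eqP->|->//]] /andP[_ yz] ->.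
    by rewrite yz.
  have nadj x y : x != y -> ~~ blow_up_adj x y ->
      (f x != f y) && ~~ adj B (f x) (f y).
    by rewrite /blow_up_adj => ->; rewrite negb_or.
  case/and5P: C => /= /and4P[ab bc cd da] ac bd nac nbd.
  have nca : ~~ blow_up_adj c a by rewrite blow_up_sym.
  have ndb : ~~ blow_up_adj d b by rewrite blow_up_sym.
  have ca : c != a by rewrite eq_sym.
  have db : d != b by rewrite eq_sym.
  case/negP: (C4_free (f a) (f b) (f c) (f d)); rewrite /induced_C4.
  rewrite (lift _ _ _ ab bc) // (lift _ _ _ bc cd) // (lift _ _ _ cd da) //.
  rewrite (lift _ _ _ da ab) //.
  by have /andP[-> ->] := nadj _ _ ac nac; have /andP[-> ->] := nadj _ _ bd nbd.
case: ifPn => /= adj_uv; apply/has_induced_C4P.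
  have [|a [b [ab nab /andP[ua va] /andP[ub vb]]]] := @edge_diamond (f u) (f v).
    by case/andP: adj_uv.
  have del w x : adj B (f u) w -> adj B (f v) w -> x \in [:: u; v] ->
      adj (del_edge blow_up u v) x (g w).
    move=> uw vw xuv; rewrite /= /del_edge_adj /= adjfg /=; last first.
      by move: xuv; rewrite !inE => /orP[] /eqP->.
    (* The vertex [g w] is neither [u] nor [v], since [w] is adjacent to both [f u] and [f v]. *)
    apply/eqP=> /set2_eq[] [_ e].
      by rewrite -e gK adj_irr in vw.
    by rewrite -e gK adj_irr in uw.
  have ndel : adj (del_edge blow_up u v) (g a) (g b) = false.
    by rewrite /= /del_edge_adj /= (negPf (nadjfg _ _)) // gK.
  exists u, (g a), v, (g b); rewrite /induced_C4 ndel.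
  rewrite (adj_sym _ (g a)) (adj_sym _ (g b) u) !del ?inE ?eqxx ?orbT // uv.
  by rewrite (can_eq gK) ab /= /del_edge_adj eqxx andbF.
have [fuv nfuv] : f u != f v /\ ~~ adj B (f u) (f v).
  by move: adj_uv; rewrite /blow_up_adj uv /= negb_or => /andP.
have [a [b [ua ab bv nub nav]]] := nonedge_P4 fuv nfuv.
have add x y : blow_up_adj x y -> adj (add_edge blow_up u v) x y.
  by rewrite /= /add_edge_adj /= => ->.
have ub : f u != b by apply: contraNneq nfuv => ->.
have va : f v != a by apply: contraNneq nfuv => ->.
have ua' := adj_neq ua; have vb : f v != b by rewrite eq_sym (adj_neq bv).
have neq x w : f x != w -> x != g w by apply: contraNneq => ->; rewrite gK.
have nadd x w : x \in [:: u; v] -> f u != w -> f v != w ->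
    ~~ adj B (f x) w -> ~~ adj (add_edge blow_up u v) x (g w).
  move=> xuv uw vw nxw; rewrite /= /add_edge_adj /= negb_or nadjfg //=.
    rewrite negb_and orbC; apply/orP; left; apply/eqP=> /set2_eq[] [_ e].
      by rewrite -e gK eqxx in vw.
    by rewrite -e gK eqxx in uw.
  by move: xuv; rewrite !inE => /orP[] /eqP->.
have vu : adj (add_edge blow_up u v) v u.
  by rewrite /= /add_edge_adj eq_sym uv setUC eqxx orbT.
exists u, (g a), (g b), v; rewrite /induced_C4 vu (eq_sym (g a)) !neq //.
rewrite (adj_sym _ (g b)) (adj_sym _ (g a) v).
rewrite (negPf (nadd u b _ _ _ _)) ?inE ?eqxx //.
rewrite (negPf (nadd v a _ _ _ _)) ?inE ?eqxx ?orbT 1?adj_sym //.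
by rewrite !add // 1?(blow_up_sym (g a) u) adjfg ?gK // adj_sym.
Qed.

End BlowUp.

(** * The circulant graph on Z/21, checked by computation *)

(** Lets claims about ordinals be decided by [vm_compute] on lists of naturals. *)
Lemma all_ord n (P : pred nat) : all P (iota 0 n) -> forall i : 'I_n, P i.
Proof. by move=> /allP allP i; apply: allP; rewrite mem_iota ltn_ord. Qed.

Lemma has_ord n (P : pred nat) : has P (iota 0 n) -> exists i : 'I_n, P i.
Proof. by case/hasP=> i; rewrite mem_iota => lt_in; exists (Ordinal lt_in). Qed.

(* Truncated subtraction makes [(i - j) + (j - i)] the distance |i - j|. *)
Definition torus_nat_adj (i j : nat) : bool :=
  (i - j) + (j - i) \in [:: 1; 4; 5; 16; 17; 20].

(** The distances 16, 17, 20 are 21 - 5, 21 - 4, 21 - 1, so adjacency means a difference of 1, 4 or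
    5 up to sign modulo 21. *)
Definition torus_adj : rel 'I_21 := fun i j => torus_nat_adj i j.

Lemma torus_sym : symmetric torus_adj.
Proof. by move=> i j; rewrite /torus_adj /torus_nat_adj addnC. Qed.

Lemma torus_irr : irreflexive torus_adj.
Proof. by move=> i; rewrite /torus_adj /torus_nat_adj subnn. Qed.

Definition torus : sgraph 'I_21 := SGraph torus_sym torus_irr.

(** Exhaustive check that two distinct common neighbours of distinct nonadjacent vertices are
    adjacent. *)
Lemma torus_C4_free (a b c d : 'I_21) : ~~ induced_C4 torus a b c d.
Proof.
apply/negP=> /and5P[/and4P[ab bc cd da] ac bd nac nbd].
suff /all_ord/(_ a)/all_ord/(_ b)/implyP/(_ ab)/all_ord/(_ c)/implyP/(_ bc)
     /implyP/(_ nac)/implyP/(_ ac)/all_ord/(_ d)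
     /implyP/(_ cd)/implyP/(_ da)/implyP/(_ bd) :
  all (fun a => all (fun b => torus_nat_adj a b ==>
    all (fun c => torus_nat_adj b c ==> ~~ torus_nat_adj a c ==> (a != c) ==>
      all (fun d => torus_nat_adj c d ==> torus_nat_adj d a ==> (b != d) ==>
        torus_nat_adj b d) (iota 0 21)) (iota 0 21)) (iota 0 21)) (iota 0 21).
  by apply/negP.
by vm_compute.
Qed.

(** The two triangles on an edge have nonadjacent apexes; for [u = v], any two nonadjacent
    neighbours serve. *)
Lemma torus_edge_diamond (u v : 'I_21) : (u == v) || adj torus u v ->
  exists a b, [/\ a != b, ~~ adj torus a b, adj torus u a && adj torus v a
                & adj torus u b && adj torus v b].
Proof.
move=> uv.
suff :
  all (fun u => all (fun v => (u == v) || torus_nat_adj u v ==>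
    has (fun a => has (fun b => [&& a != b, ~~ torus_nat_adj a b,
      torus_nat_adj u a && torus_nat_adj v a
      & torus_nat_adj u b && torus_nat_adj v b])
    (iota 0 21)) (iota 0 21)) (iota 0 21)) (iota 0 21).
  move=> /all_ord/(_ u)/all_ord/(_ v)/implyP/(_ uv)/has_ord[a].
  by case/has_ord=> b /and4P[? ? ? ?]; exists a, b.
by vm_compute.
Qed.

Lemma torus_nonedge_P4 (u v : 'I_21) : u != v -> ~~ adj torus u v ->
  exists a b, [/\ adj torus u a, adj torus a b, adj torus b v,
                  ~~ adj torus u b & ~~ adj torus a v].
Proof.
move=> uv nuv.
suff :
  all (fun u => all (fun v => (u != v) ==> ~~ torus_nat_adj u v ==>
    has (fun a => has (fun b => [&& torus_nat_adj u a, torus_nat_adj a b,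
      torus_nat_adj b v, ~~ torus_nat_adj u b & ~~ torus_nat_adj a v])
    (iota 0 21)) (iota 0 21)) (iota 0 21)) (iota 0 21).
  move=> /all_ord/(_ u)/all_ord/(_ v)/implyP/(_ uv)/implyP/(_ nuv)/has_ord[a].
  by case/has_ord=> b /and5P[? ? ? ? ?]; exists a, b.
by vm_compute.
Qed.

(** None of the distances 1, 4, 5, 16, 17, 20 is a multiple of 3. *)
Lemma torus_independent (r s : nat) : r < 7 -> s < 7 ->
  ~~ torus_nat_adj (3 * r) (3 * s).
Proof.
move=> lt_r7 lt_s7.
suff /all_ord/(_ (Ordinal lt_r7))/all_ord/(_ (Ordinal lt_s7)) : all (fun r =>
  all (fun s => ~~ torus_nat_adj (3 * r) (3 * s)) (iota 0 7)) (iota 0 7) by [].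
by vm_compute.
Qed.

(** * The blow-up on [n] vertices and its edge count *)

(* Vertices 0..20 represent all the classes; the others are spread evenly over
   the independent set of multiples of 3. *)
Definition torus_class (i : nat) : nat := if i < 21 then i else 3 * (i %% 7).

Lemma torus_class_lt (i : nat) : torus_class i < 21.
Proof. by rewrite /torus_class; case: ifP => //; lia. Qed.

Definition torus_map n (i : 'I_n) : 'I_21 := Ordinal (torus_class_lt i).

Definition torus_blow_up n : sgraph 'I_n := blow_up torus (@torus_map n).

Lemma torus_blow_up_saturated n : 21 <= n ->
  induced_saturated C4 (torus_blow_up n).
Proof.
move=> le21n.
(* Each class [i] is represented by the vertex [i] itself. *)
apply: (blow_up_saturated torus_C4_free torus_edge_diamond torus_nonedge_P4
         (g := widen_ord le21n)).
by move=> i; apply: val_inj; rewrite /= /torus_class ltn_ord.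
Qed.

(** Within a residue class [j] is determined by [j %/ 7], which is at most [n %/ 7]. *)
Lemma card_residue n (r : nat) :
  #|[set j : 'I_n | j %% 7 == r]| <= (n %/ 7).+1.
Proof.
pose q (j : 'I_n) : 'I_(n %/ 7).+1 := inord (j %/ 7).
have qE j : q j = j %/ 7 :> nat by rewrite inordK // ltnS leq_div2r // ltnW.
rewrite -[leqRHS]card_ord -(card_in_imset (f := q)) ?max_card //.
move=> j k; rewrite !inE => /eqP jr /eqP kr /(congr1 val) /=.
rewrite !qE => jk; apply: val_inj.
by rewrite /= (divn_eq j 7) (divn_eq k 7) jr kr jk.
Qed.

(** At most 21 vertices have degree bounded only by [n]; the others have degree at most 22 + n/7.
    Summing and multiplying by 7 gives 301 = 7 * (21 + 22). *)
Lemma torus_blow_up_num_edges n :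
  14 * num_edges (torus_blow_up n) <= n ^ 2 + 301 * n.
Proof.
pose L := [set i : 'I_n | i < 21].
have cardL : #|L| <= 21.
  rewrite -[leqRHS]card_ord -(card_in_imset (f := @torus_map n)) ?max_card //.
  move=> i j; rewrite !inE => i21 j21 /(congr1 val) /=.
  by rewrite /torus_class i21 j21 => /val_inj.
have deg (x : 'I_n) : #|[set y | adj (torus_blow_up n) x y]|
    <= (x \in L) * n + (21 + (n %/ 7).+1).
  have [xL|xL] := boolP (x \in L).
    by rewrite mul1n (leq_trans (max_card _)) // card_ord leq_addr.
  rewrite mul0n add0n (leq_trans _ (leq_add cardL (card_residue n (x %% 7)))) //.
  rewrite (leq_trans _ (leq_card_setU _ _).1) // subset_leq_card //.
  apply/subsetP=> y; rewrite !inE; move: xL; rewrite inE => /negPf x21.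
  case/andP=> _; rewrite -(inj_eq val_inj) /= /torus_adj /= /torus_class x21.
  (* Either [y] is in [L], or both classes are multiples of 3 and, by independence, coincide. *)
  case: ltnP => //= _.
  rewrite (negPf (torus_independent _ _)) ?ltn_pmod // orbF.
  by rewrite eqn_pmul2l // eq_sym.
have := double_num_edges (torus_blow_up n).
rewrite -sum1dep_card.
rewrite -(pair_big_dep xpredT (adj (torus_blow_up n)) (fun _ _ => 1)) /=.
have : \sum_(x : 'I_n) \sum_(y | adj (torus_blow_up n) x y) 1
    <= \sum_(x : 'I_n) ((x \in L) * n + (21 + (n %/ 7).+1)).
  by apply: leq_sum => x _; rewrite sum1dep_card.
rewrite big_split /= -big_distrl /= sum_nat_const card_ord.
have -> : \sum_(x : 'I_n) (x \in L) = #|L|.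
  by rewrite -sum1_card [RHS]big_mkcond; apply: eq_bigr => x _; case: (x \in L).
move=> le_sum eq_sum; rewrite -eq_sum in le_sum.
have le1 : #|L| * n <= 21 * n by rewrite leq_mul2r cardL orbT.
have le2 : n * (7 * (n %/ 7)) <= n * n by rewrite leq_mul2l; lia.
nia.
Qed.

(** * Existence of the minimum and the two bounds *)

(** The set of edge counts of saturated graphs is nonempty, so it has a least element; [asbool]
    makes membership boolean for [ex_minnP]. *)
Lemma sis_exists n (W : finType) (H : sgraph W) (G : sgraph 'I_n) :
  induced_saturated H G -> exists2 m, is_sis n H m & m <= num_edges G.
Proof.
move=> satG.
pose P m :=
  `[< exists G : sgraph 'I_n, induced_saturated H G /\ num_edges G = m >].
have exP : exists m, P m by exists (num_edges G); apply/asboolP; exists G.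
case: (ex_minnP exP) => m /asboolP Pm min_m; exists m.
  by split=> // G' satG'; apply: min_m; apply/asboolP; exists G'.
by apply: min_m; apply/asboolP; exists G.
Qed.

Local Open Scope ring_scope.

Theorem theorem5p5 (R : realType) :
  exists C : R, exists N : nat, forall n : nat, (N <= n)%N ->
    exists m : nat, is_sis n C4 m /\
      5 / 2 * n%:R <= m%:R :> R /\
      m%:R <= 7 / 64 * n%:R ^+ 2 + C * n%:R :> R.
Proof.
(* 22 exceeds 301/14, and with 21 vertices every class has a representative. *)
exists 22, 21%N => n le21n.
have [m sis_m le_m] := sis_exists (torus_blow_up_saturated le21n).
exists m; split=> //; split.
  case: sis_m => -[G [satG <-]] _.
  have := saturated_num_edges _ satG; rewrite card_ord => /(_ (leq_trans _ le21n)).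
  move=> /(_ isT); rewrite -(ler_nat R) -muln2 !natrM; lra.
have : (14 * m <= n ^ 2 + 301 * n)%N.
  by rewrite (leq_trans _ (torus_blow_up_num_edges n)) // leq_mul2l.
rewrite -(ler_nat R) natrD natrX !natrM => le_mn.
(* Nonnegativity of the square lets 1/14 be relaxed to 7/64. *)
have := sqr_ge0 (n%:R : R); have := ler0n R n; lra.
Qed.
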